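(* For the half-line graph $\mathbb{N}$, consider metrics $g=\sum_{i\ge1}h_i(\phi_i a_i\otimes a_i'+\epsilon a_i'\otimes a_i)$ with $h_i\ne0$, $\epsilon=\pm1$, and the quantum Riemannian geometries given, for initial values $\phi_1,\tau_1\neq0$, by $$\phi_{i+1}=\phi_1-\frac1{\phi_i},\quad \tau_{i+1}=-1+\frac{\phi_{i+1}}{\phi_i+\epsilon\tau_i},\quad \tau_i'=\epsilon\frac{\phi_i-\phi_{i+1}}{\tau_i},\quad \sigma_i=\frac{h_{i+1}\phi_{i+1}}{h_i\phi_i(1+\tau_i')},\quad \sigma_i'=\frac{h_{i-1}(\phi_{i-1}+\epsilon\tau_{i-1})}{h_i\phi_i}.$$ The canonical choice of direction coefficients $\phi_i$ is given by $\phi_1=2$. With this choice, if the metric coefficients $h_i$ and the initial $\tau_1$ are rational, then all coefficients of the quantum geometry ($\phi_i,\tau_i,\tau_i',\sigma_i,\sigma_i'$) are rational. In particular, for initial $\tau_1=s=\pm1$ and $\epsilon=1$, $$\phi_i=\frac{i+1}{i},\qquad \tau_i=\frac{s(-1)^{i-1}}{i},\qquad \tau_i'=-\tau_{i+1},\qquad \sigma_i=\frac{h_{i+1}}{h_i}(1+\tau_{i+1}),\qquad \sigma_i'=\frac{h_{i-1}}{h_i}\,\frac1{1+\tau_i}.$$ This is called the canonical quantum Riemannian geometry of $\mathbb{N}$.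
   Context: **Calculus.** $\mathbb{N}=\{1,2,3,\dots\}$ is the graph with an edge $i - (i+1)$ for each $i\ge1$. $A=\mathbb{C}(\mathbb{N})$ is the algebra of complex functions on the vertices. $\Omega^1$ is the space of all (possibly infinite) linear combinations of the arrows $a_i=\omega_{i\to i+1}$ and $a_i'=\omega_{i+1\to i}$, $i\ge1$. It is an $A$-bimodule via $f a_i=f(i)a_i$, $a_i f=f(i+1)a_i$, $f a_i'=f(i+1)a_i'$, $a_i'f=f(i)a_i'$, with exterior derivative $\mathrm{d}f=\sum_i (f(i+1)-f(i))(a_i-a_i')$. $\Omega^1\otimes_A\Omega^1$ consists of (possibly infinite) linear combinations of 2-step paths $a_i\otimes a_{i+1}$, $a_{i+1}'\otimes a_i'$, $a_i\otimes a_i'$, $a_i'\otimes a_i$ ($\otimes$ means $\otimes_A$), and similarly for more factors. $\Omega^2$ is the quotient of $\Omega^1\otimes_A\Omega^1$ (with quotient map $\wedge$) by the relations $a_i\wedge a_{i+1}=0$, $a_{i+1}'\wedge a_i'=0$, $a_1\wedge a_1'=0$, $a_{i+1}\wedge a_{i+1}'+a_i'\wedge a_i=0$ for $i\ge1$. With $\theta=\sum_i(a_i+a_i')$, $\mathrm{d}:\Omega^1\to\Omega^2$ is $\mathrm{d}\omega=\theta\wedge\omega+\omega\wedge\theta$. **Connections.** A bimodule connection on $\Omega^1$ is a linear map $\nabla:\Omega^1\to\Omega^1\otimes_A\Omega^1$ together with a bimodule map $\sigma:\Omega^1\otimes_A\Omega^1\to\Omega^1\otimes_A\Omega^1$ such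 that $\nabla(f\omega)=\mathrm{d}f\otimes\omega+f\nabla\omega$ and $\nabla(\omega f)=(\nabla\omega)f+\sigma(\omega\otimes\mathrm{d}f)$. It extends to tensor products by $\nabla(\omega\otimes\eta)=\nabla\omega\otimes\eta+(\sigma(\omega\otimes(\ ))\otimes\mathrm{id})\nabla\eta$. It is a quantum Levi-Civita connection (QLC) for $g$ if $\wedge\nabla=\mathrm{d}$ on $\Omega^1$ and $\nabla g=0$. A quantum Riemannian geometry here means a metric $g$ together with a QLC for it. **Connection coefficients.** The connection with coefficients $\tau_i,\tau_i',\sigma_i$ ($i\ge1$), $\sigma_i'$ ($i\ge2$) is $\nabla\omega=\theta\otimes\omega-\sigma(\omega\otimes\theta)$ with $\sigma(a_i\otimes a_{i+1})=\sigma_i\,a_i\otimes a_{i+1}$; $\sigma(a_i'\otimes a_{i-1}')=\sigma_i'\,a_i'\otimes a_{i-1}'$ ($i\ge2$); $\sigma(a_1\otimes a_1')=\tau_1\,a_1\otimes a_1'$; $\sigma(a_i\otimes a_i')=\tau_i\,a_i\otimes a_i'+(1+\tau_i)\,a_{i-1}'\otimes a_{i-1}$ ($i\ge2$); $\sigma(a_i'\otimes a_i)=\tau_i'\,a_i'\otimes a_i+(1+\tau_i')\,a_{i+1}\otimes a_{i+1}'$ ($i\ge 1$). *)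

(* Defs.v *)
From HB Require Import structures.
From mathcomp Require Import all_boot all_order all_algebra.
From mathcomp Require Import boolp classical_sets functions fsbigop reals.
From mathcomp Require Import complex.
Set Implicit Arguments.
Unset Strict Implicit.
Unset Printing Implicit Defensive.

Import GRing.Theory.
Local Open Scope ring_scope.
Local Open Scope classical_set_scope.

Definition vertex := {i : nat | (0 < i)%N}.

Definition adjacent (x y : vertex) : bool :=
  (val y == (val x).+1) || (val x == (val y).+1).

Record arrow := Arrow {
  src : vertex;
  tgt : vertex;
  arrow_adj : adjacent src tgt }.

Record path2 := Path2 {
  fst2 : arrow;
  snd2 : arrow;
  path2_comp : tgt fst2 == src snd2 }.

Record path3 := Path3 {
  fst3 : arrow;
  mid3 : arrow;
  lst3 : arrow;
  path3_compl : tgt fst3 == src mid3;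
  path3_compr : tgt mid3 == src lst3 }.

Definition init3 (p : path3) : path2 := Path2 (path3_compl p).
Definition tail3 (p : path3) : path2 := Path2 (path3_compr p).

Section Calculus.
Variable F : fieldType.

(* An infinite linear combination of n-step paths is its family of
   coefficients.  Tensor products are over [Fun], so only composable paths
   occur; since the graph has bounded degree, every element of [Omega2] or
   [Omega3] is a finite sum of pure tensors. *)
Local Notation Fun := (vertex -> F^o).
Local Notation Omega1 := (arrow -> F^o).
Local Notation Omega2 := (path2 -> F^o).
Local Notation Omega3 := (path3 -> F^o).


Definition lact1 (f : Fun) (w : Omega1) : Omega1 := fun p => f (src p) * w p.
Definition ract1 (w : Omega1) (f : Fun) : Omega1 := fun p => w p * f (tgt p).
Definition lact2 (f : Fun) (u : Omega2) : Omega2 :=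
  fun p => f (src (fst2 p)) * u p.
Definition ract2 (u : Omega2) (f : Fun) : Omega2 :=
  fun p => u p * f (tgt (snd2 p)).

Definition tens (w e : Omega1) : Omega2 := fun p => w (fst2 p) * e (snd2 p).
Definition tensl (w : Omega1) (u : Omega2) : Omega3 :=
  fun p => w (fst3 p) * u (tail3 p).
Definition tensr (u : Omega2) (e : Omega1) : Omega3 :=
  fun p => u (init3 p) * e (lst3 p).

(* [ar i] is the arrow i -> i+1 and [ar' i] the arrow i+1 -> i; both are 0 for
   i = 0, which is not a vertex. *)
Definition ar (i : nat) : Omega1 :=
  fun p => ((val (src p) == i) && (val (tgt p) == i.+1))%:R.
Definition ar' (i : nat) : Omega1 :=
  fun p => ((val (src p) == i.+1) && (val (tgt p) == i))%:R.

(* Formal sum over i >= 1.  It is only applied to families in which every path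
   has a nonzero coefficient for finitely many i, so that the finitely supported
   sum is the intended one. *)
Definition fsum (P : Type) (w : nat -> P -> F^o) : P -> F^o :=
  fun p => \sum_(i \in [set i : nat | (0 < i)%N]) w i p.

Definition theta : Omega1 := fsum (fun i => ar i + ar' i).

(* The coefficients of sum_i (f(i+1) - f(i)) (ar i - ar' i). *)
Definition d0 (f : Fun) : Omega1 := fun p => f (tgt p) - f (src p).

(* Two elements of [Omega2] have the same image under the wedge quotient. *)
Definition eq_wedge (u v : Omega2) : Prop :=
  exists (b c k : nat -> F) (e : F),
    u - v = (fsum (fun i => b i *: tens (ar i) (ar i.+1)) : Omega2)
          + (fsum (fun i => c i *: tens (ar' i.+1) (ar' i)) : Omega2)
          + e *: tens (ar 1%N) (ar' 1%N)
          + (fsum (fun i => k i *: (tens (ar i.+1) (ar' i.+1)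
                                    + tens (ar' i) (ar i))) : Omega2).

(* A representative in [Omega2] of the exterior derivative of w. *)
Definition d1 (w : Omega1) : Omega2 := tens theta w + tens w theta.

Definition bimodule_map (s : Omega2 -> Omega2) : Prop :=
  [/\ linear s,
      forall f u, s (lact2 f u) = lact2 f (s u)
    & forall u f, s (ract2 u f) = ract2 (s u) f].

Definition bimodule_connection (nabla : Omega1 -> Omega2)
    (s : Omega2 -> Omega2) : Prop :=
  [/\ linear nabla, bimodule_map s,
      forall f w, nabla (lact1 f w) = tens (d0 f) w + lact2 f (nabla w)
    & forall w f, nabla (ract1 w f) = ract2 (nabla w) f + s (tens w (d0 f))].

Definition torsion_free (nabla : Omega1 -> Omega2) : Prop :=
  forall w, eq_wedge (nabla w) (d1 w).

(* Pure tensors span, so [sid] = s (x) id and the extension [nabla2] of the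
   connection are uniquely determined by the conditions below. *)
Definition tensor_id (s : Omega2 -> Omega2) (sid : Omega3 -> Omega3) : Prop :=
  linear sid /\ forall u e, sid (tensr u e) = tensr (s u) e.

Definition tensor_connection (nabla : Omega1 -> Omega2)
    (s : Omega2 -> Omega2) (nabla2 : Omega2 -> Omega3) : Prop :=
  linear nabla2 /\
  exists2 sid, tensor_id s sid &
    forall w e, nabla2 (tens w e) = tensr (nabla w) e + sid (tensl w (nabla e)).

Definition metric_compatible (g : Omega2) (nabla : Omega1 -> Omega2)
    (s : Omega2 -> Omega2) : Prop :=
  exists2 nabla2, tensor_connection nabla s nabla2 & nabla2 g = 0.

(* g has an inverse bimodule map ip = ( , ), that is,
   ((w, ) (x) id) g = w = (id (x) ( , w)) g for all w. *)
Definition metric (g : Omega2) : Prop :=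
  exists (ip : Omega2 -> Fun) (ipid idip : Omega3 -> Omega1),
    [/\ linear ip,
        forall f u x, ip (lact2 f u) x = f x * ip u x
      & forall u f x, ip (ract2 u f) x = ip u x * f x] /\
    [/\ linear ipid, forall u e, ipid (tensr u e) = lact1 (ip u) e,
        linear idip & forall e u, idip (tensl e u) = ract1 e (ip u)] /\
    forall w, ipid (tensl w g) = w /\ idip (tensr g w) = w.

Definition qlc (g : Omega2) (nabla : Omega1 -> Omega2)
    (s : Omega2 -> Omega2) : Prop :=
  [/\ bimodule_connection nabla s, torsion_free nabla
    & metric_compatible g nabla s].

(* The bimodule map s is determined by its values on the 2-step paths. *)
Definition has_coefficients (t t' s_ s'_ : nat -> F)
    (nabla : Omega1 -> Omega2) (s : Omega2 -> Omega2) : Prop :=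
  [/\ bimodule_map s & forall w, nabla w = tens theta w - s (tens w theta)] /\
  [/\ forall i, (0 < i)%N ->
        s (tens (ar i) (ar i.+1)) = s_ i *: tens (ar i) (ar i.+1),
      forall i, (1 < i)%N ->
        s (tens (ar' i) (ar' i.-1)) = s'_ i *: tens (ar' i) (ar' i.-1),
      s (tens (ar 1%N) (ar' 1%N)) = t 1%N *: tens (ar 1%N) (ar' 1%N),
      forall i, (1 < i)%N ->
        s (tens (ar i) (ar' i))
        = t i *: tens (ar i) (ar' i) + (1 + t i) *: tens (ar' i.-1) (ar i.-1)
    & forall i, (0 < i)%N ->
        s (tens (ar' i) (ar i))
        = t' i *: tens (ar' i) (ar i)
          + (1 + t' i) *: tens (ar i.+1) (ar' i.+1)].

(* All coefficients below are indexed by i >= 1 (i >= 2 for [sigma']); the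
   values at smaller indices are irrelevant. *)
Fixpoint phi (phi1 : F) (i : nat) : F :=
  if i is j.+1 then
    if j is 0%N then phi1 else phi1 - (phi phi1 j)^-1
  else 0.

Fixpoint tau (eps phi1 tau1 : F) (i : nat) : F :=
  if i is j.+1 then
    if j is 0%N then tau1
    else -1 + phi phi1 j.+1 / (phi phi1 j + eps * tau eps phi1 tau1 j)
  else 0.

Definition tau' (eps phi1 tau1 : F) (i : nat) : F :=
  eps * ((phi phi1 i - phi phi1 i.+1) / tau eps phi1 tau1 i).

Definition sigma (h : nat -> F) (eps phi1 tau1 : F) (i : nat) : F :=
  (h i.+1 * phi phi1 i.+1) / (h i * phi phi1 i * (1 + tau' eps phi1 tau1 i)).

Definition sigma' (h : nat -> F) (eps phi1 tau1 : F) (i : nat) : F :=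
  (h i.-1 * (phi phi1 i.-1 + eps * tau eps phi1 tau1 i.-1))
  / (h i * phi phi1 i).

(* No denominator in the recursion vanishes (given h i != 0). *)
Definition well_defined (eps phi1 tau1 : F) : Prop :=
  forall i, (0 < i)%N ->
    [/\ phi phi1 i != 0, tau eps phi1 tau1 i != 0,
        phi phi1 i + eps * tau eps phi1 tau1 i != 0
      & 1 + tau' eps phi1 tau1 i != 0].

Definition edge_metric (h : nat -> F) (eps phi1 : F) : Omega2 :=
  fsum (fun i => h i *: (phi phi1 i *: tens (ar i) (ar' i)
                         + eps *: tens (ar' i) (ar i))).

Definition is_geometry (h : nat -> F) (eps phi1 tau1 : F) : Prop :=
  metric (edge_metric h eps phi1) /\
  exists nabla s,
    has_coefficients (tau eps phi1 tau1) (tau' eps phi1 tau1)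
      (sigma h eps phi1 tau1) (sigma' h eps phi1 tau1) nabla s /\
    qlc (edge_metric h eps phi1) nabla s.

Definition is_rational (z : F) : Prop := exists q : rat, z = ratr q.

End Calculus.

(* Main.v *)
(* Since sigma preserves the endpoints of paths, every condition becomes a scalar
   identity for each path of the half-line.  For g supported on the loops
   x -> y -> x, nabla g = theta (x) g - (sigma (x) id)(id (x) sigma)(g (x) theta),
   and its coefficients on the 3-step paths vanish exactly by the recursion:
   phi_(i+1) + 1/phi_i is constant and
   tau_(i+1) (phi_i + eps tau_i) = phi_(i+1) - phi_i - eps tau_i.
   Torsion freeness holds since sigma + 1 has equal entries in each column of a
   2 x 2 loop block.  For phi_1 = 2 and tau_1 = s with s^2 = 1 the closed formulas
   follow by induction from (s (-1)^i)^2 = 1. *)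
Require Import Defs.
From mathcomp Require Import all_boot all_order all_algebra.
From mathcomp Require Import boolp classical_sets functions fsbigop reals complex.
From mathcomp Require Import ring zify.

Set Implicit Arguments.
Unset Strict Implicit.
Unset Printing Implicit Defensive.

Import GRing.Theory Num.Theory.
Local Open Scope ring_scope.

(** * Scalar identities behind metric compatibility *)

Section Coefficients.
Variables (F : fieldType) (h : nat -> F) (eps phi1 tau1 : F).
Hypothesis h_neq0 : forall i, (0 < i)%N -> h i != 0.
Hypothesis eps2 : eps * eps = 1.
Hypothesis wd : well_defined eps phi1 tau1.

Local Notation f := (phi phi1).
Local Notation t := (tau eps phi1 tau1).
Local Notation t' := (tau' eps phi1 tau1).
Local Notation sg := (sigma h eps phi1 tau1).
Local Notation sg' := (sigma' h eps phi1 tau1).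

Lemma phiS i : f i.+2 = phi1 - (f i.+1)^-1.
Proof. by []. Qed.

(** Both values on the left are [phi1] minus the inverse of the preceding one, so [phi1] cancels.
    This brings the numerators of two consecutive [tau'] to the same difference. *)
Lemma phiB i : f i.+1 != 0 -> f i.+2 != 0 ->
  f i.+2 - f i.+3 = (f i.+1 - f i.+2) / (f i.+1 * f i.+2).
Proof.
move=> f1 f2; rewrite (phiS i.+1).
have {2}-> : phi1 = f i.+2 + (f i.+1)^-1 by rewrite phiS subrK.
by field; rewrite f1 f2.
Qed.

Lemma tauS i : t i.+2 = -1 + f i.+2 / (f i.+1 + eps * t i.+1).
Proof. by []. Qed.

(* The compatibility condition nabla g = 0 along each type of 3-step path, where
   u is a step i -> i+1 and d a step i+1 -> i; udu1 is the path from vertex 1. *)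
Lemma compat_udu1 : t 1%N * (t' 1%N * (h 1%N * f 1%N)) = eps * h 1%N.
Proof.
have [f0 t0 _ _] := @wd 1%N isT.
(* At index 1 the recursion gives [phi1 - f 2 = phi1^-1], so [t' 1] is [eps / (phi1 * t 1)]. *)
rewrite /tau' phiS; change (f 1%N) with phi1 in f0 |- *.
by field; rewrite f0 t0.
Qed.

(** The products eliminate [tau]: the two terms are [eps * h i.+2] times [1 - f i.+2 / f i.+1] and
    [f i.+2 / f i.+1]. *)
Lemma compat_udu i :
  t i.+2 * (t' i.+2 * (h i.+2 * f i.+2))
    + (1 + t' i.+1) * (sg i.+1 * (eps * h i.+1)) = eps * h i.+2.
Proof.
have [f1 t1 _ t'1] := @wd i.+1 isT; have [f2 t2 _ t'2] := @wd i.+2 isT.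
have h1 := @h_neq0 i.+1 isT.
rewrite /sigma {1}/tau' phiB //.
by field; rewrite f1 f2 t2 t'1 h1.
Qed.

Lemma compat_duu i :
  (1 + t i.+2) * (t' i.+2 * (h i.+2 * f i.+2))
    + t' i.+1 * (sg i.+1 * (eps * h i.+1)) = 0.
Proof.
have [f1 t1 P1 t'1] := @wd i.+1 isT; have [f2 t2 _ t'2] := @wd i.+2 isT.
have h1 := @h_neq0 i.+1 isT.
have e0 : eps != 0 by apply: contra_eq_neq eps2 => ->; rewrite mul0r eq_sym oner_neq0.
(* The recursion for [tau] cleared of its denominator. With [t'P] it writes [1 + t i.+2] and
   [1 + t' i.+1] through the same factor [f i.+1 + eps * t i.+1]; since [sigma] divides by the
   second one, the two terms become opposite. *)
have tP : t i.+2 * (f i.+1 + eps * t i.+1) = f i.+2 - (f i.+1 + eps * t i.+1).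
  by rewrite tauS; field.
(* Uses [eps * eps = 1] to take [- eps] out of [t i.+1 + eps * (f i.+1 - f i.+2)]. *)
have t'P : (1 + t' i.+1) * t i.+1 = - eps * (t i.+2 * (f i.+1 + eps * t i.+1)).
  by rewrite tP /tau' mulrDl mul1r -mulrA divfK // -[in LHS](mul1r (t _)) -eps2; ring.
rewrite /sigma.
have -> : 1 + t i.+2 = f i.+2 / (f i.+1 + eps * t i.+1) by rewrite tauS addNKr.
have -> : 1 + t' i.+1 = - eps * (t i.+2 * (f i.+1 + eps * t i.+1)) / t i.+1.
  by rewrite -t'P mulfK.
rewrite /tau' phiB //; field.
by rewrite oppr_eq0 e0 f1 f2 t1 t2 P1 h1.
Qed.

Lemma compat_uud i : (0 < i)%N ->
  sg i * ((1 + t' i) * (h i * f i)) = h i.+1 * f i.+1.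
Proof.
move=> i0; have [f1 t1 _ t'1] := wd i0; have h1 := h_neq0 i0.
by rewrite /sigma; field; rewrite f1 t'1 h1.
Qed.

Lemma sigma'M i :
  sg' i.+2 * (h i.+2 * f i.+2) = h i.+1 * (f i.+1 + eps * t i.+1).
Proof.
have [f2 _ _ _] := @wd i.+2 isT; have h2 := @h_neq0 i.+2 isT.
by rewrite /sigma' divfK // mulf_neq0.
Qed.

Lemma compat_udd i :
  t i.+2 * (sg' i.+2 * (h i.+2 * f i.+2))
    + (1 + t' i.+1) * (t i.+1 * (eps * h i.+1)) = 0.
Proof.
have [f1 t1 P1 t'1] := @wd i.+1 isT.
rewrite sigma'M tauS /tau'.
(* The value of the left side before [eps * eps = 1] is used, which [field] cannot know. *)
transitivity ((eps * eps - 1) * (f i.+1 - f i.+2) * h i.+1); last first.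
  by rewrite eps2 subrr !mul0r.
by field; rewrite t1 P1.
Qed.

Lemma compat_dud i :
  (1 + t i.+2) * (sg' i.+2 * (h i.+2 * f i.+2))
    + t' i.+1 * (t i.+1 * (eps * h i.+1)) = h i.+1 * f i.+1.
Proof.
have [f1 t1 P1 t'1] := @wd i.+1 isT.
rewrite sigma'M tauS /tau'.
transitivity (h i.+1 * f i.+2 + (eps * eps) * (f i.+1 - f i.+2) * h i.+1).
  by field; rewrite t1 P1.
by rewrite eps2; ring.
Qed.

Lemma compat_ddu i :
  sg' i.+2 * ((1 + t i.+2) * (eps * h i.+2)) = eps * h i.+1.
Proof.
have [f1 t1 P1 t'1] := @wd i.+1 isT; have [f2 _ _ _] := @wd i.+2 isT.
have h2 := @h_neq0 i.+2 isT.
by rewrite /sigma' succnK tauS; field; rewrite P1 f2 h2.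
Qed.
End Coefficients.

(** * Forms as functions of vertex numbers *)

Definition ext0 (F : fieldType) (P T : Type) (f : P -> T) (u : P -> F^o) (t : T) : F :=
  if pselect (exists p, f p = t) is left e then u (projT1 (cid e)) else 0.

Section Ext0.
Variables (F : fieldType) (P T : Type) (f : P -> T).

Lemma ext0E (u : P -> F^o) p : injective f -> ext0 f u (f p) = u p.
Proof.
move=> fI; rewrite /ext0; case: pselect => [e|]; last by case; exists p.
by case: (cid e) => q /= /fI ->.
Qed.

Lemma ext0_out (u : P -> F^o) t : ~ (exists p, f p = t) -> ext0 f u t = 0.
Proof. by rewrite /ext0; case: pselect. Qed.

Lemma ext0_linear a (u v : P -> F^o) t :
  ext0 f (a *: u + v) t = a * ext0 f u t + ext0 f v t.
Proof. by rewrite /ext0; case: pselect => // _; rewrite mulr0 addr0. Qed.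
End Ext0.

Definition step (x y : nat) : bool :=
  [&& 0 < x, 0 < y & (y == x.+1) || (x == y.+1)]%N.

Definition ends (p : arrow) : nat * nat := (val (src p), val (tgt p)).
Definition nodes2 (p : path2) : nat * nat * nat :=
  (ends (fst2 p), val (tgt (snd2 p))).
Definition nodes3 (p : path3) : nat * nat * nat * nat :=
  (nodes2 (init3 p), val (tgt (lst3 p))).

Lemma ends_inj : injective ends.
Proof.
case=> [x y xy] [x' y' xy'] [/val_inj/= ex /val_inj/= ey]; subst x' y'.
by rewrite (bool_irrelevance xy xy').
Qed.

Lemma val_snd2 (p : path2) : val (src (snd2 p)) = val (tgt (fst2 p)).
Proof. by case: p => a b /= /eqP ->. Qed.

Lemma val_mid3 (p : path3) : val (src (mid3 p)) = val (tgt (fst3 p)).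
Proof. by case: p => a b c /= /eqP ->. Qed.

Lemma val_lst3 (p : path3) : val (src (lst3 p)) = val (tgt (mid3 p)).
Proof. by case: p => a b c /= _ /eqP ->. Qed.

(** Composability recovers the source of the second arrow, and the remaining components are boolean
    proofs, hence unique. *)
Lemma nodes2_inj : injective nodes2.
Proof.
move=> p q pq.
have e1 : val (src (fst2 p)) = val (src (fst2 q)) := congr1 (fun t => t.1.1) pq.
have e2 : val (tgt (fst2 p)) = val (tgt (fst2 q)) := congr1 (fun t => t.1.2) pq.
have e3 : val (tgt (snd2 p)) = val (tgt (snd2 q)) := congr1 snd pq.
have := val_snd2 q; rewrite -e2 -val_snd2 => e4.
case: p q {pq} e1 e2 e3 e4 => [a b ab] [c d cd] /= e1 e2 e3 e4.
have ac : a = c by apply: ends_inj; congr pair.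
have bd : b = d by apply: ends_inj; congr pair.
by subst c d; rewrite (bool_irrelevance ab cd).
Qed.

Lemma nodes3_inj : injective nodes3.
Proof.
move=> p q pq.
have e1 : val (src (fst3 p)) = val (src (fst3 q)) := congr1 (fun t => t.1.1.1) pq.
have e2 : val (tgt (fst3 p)) = val (tgt (fst3 q)) := congr1 (fun t => t.1.1.2) pq.
have e3 : val (tgt (mid3 p)) = val (tgt (mid3 q)) := congr1 (fun t => t.1.2) pq.
have e4 : val (tgt (lst3 p)) = val (tgt (lst3 q)) := congr1 snd pq.
have := val_mid3 q; rewrite -e2 -val_mid3 => e5.
have := val_lst3 q; rewrite -e3 -val_lst3 => e6.
case: p q {pq} e1 e2 e3 e4 e5 e6 => [a b c ab bc] [a' b' c' ab' bc'] /= *.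
have ea : a = a' by apply: ends_inj; congr pair.
have eb : b = b' by apply: ends_inj; congr pair.
have ec : c = c' by apply: ends_inj; congr pair.
by subst a' b' c'; rewrite (bool_irrelevance ab ab') (bool_irrelevance bc bc').
Qed.

Lemma step_arrow (p : arrow) : step (val (src p)) (val (tgt p)).
Proof. by case: p => [[x x0] [y y0] xy]; rewrite /step /= x0 y0. Qed.

Lemma step_ex x y : step x y -> exists p, ends p = (x, y).
Proof.
case/and3P=> x0 y0 xy.
by exists (@Arrow (exist _ x x0) (exist _ y y0) xy).
Qed.

Lemma step2_ex x y z : step x y -> step y z ->
  exists2 p, ends (fst2 p) = (x, y) & ends (snd2 p) = (y, z).
Proof.
move=> /step_ex[a ea] /step_ex[b eb].
have ab : tgt a == src b.
  by apply/eqP/val_inj; exact: etrans (congr1 snd ea) (esym (congr1 fst eb)).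
by exists (Path2 ab).
Qed.

Lemma step3_ex x y z w : step x y -> step y z -> step z w ->
  exists p, [/\ ends (fst3 p) = (x, y), ends (mid3 p) = (y, z)
              & ends (lst3 p) = (z, w)].
Proof.
move=> /step_ex[a ea] /step_ex[b eb] /step_ex[c ec].
have ab : tgt a == src b.
  by apply/eqP/val_inj; exact: etrans (congr1 snd ea) (esym (congr1 fst eb)).
have bc : tgt b == src c.
  by apply/eqP/val_inj; exact: etrans (congr1 snd eb) (esym (congr1 fst ec)).
by exists (Path3 ab bc).
Qed.

Section Coordinates.
Variable F : fieldType.
Local Notation Omega1 := (arrow -> F^o).
Local Notation Omega2 := (path2 -> F^o).
Local Notation Omega3 := (path3 -> F^o).

(** Coefficients indexed by natural numbers instead of dependent paths. Off the graph they are 0, so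
    formulas may mention the neighbour [x.-1] even at vertex 1. *)
Definition at1 (w : Omega1) x y : F := ext0 ends w (x, y).
Definition at2 (u : Omega2) x y z : F := ext0 nodes2 u (x, y, z).
Definition at3 (U : Omega3) x y z w : F := ext0 nodes3 U (x, y, z, w).

Lemma at1E w p : w p = at1 w (val (src p)) (val (tgt p)).
Proof. by rewrite /at1 (ext0E _ p) //; exact: ends_inj. Qed.

Lemma at2E u p :
  u p = at2 u (val (src (fst2 p))) (val (tgt (fst2 p))) (val (tgt (snd2 p))).
Proof. by rewrite /at2 (ext0E _ p) //; exact: nodes2_inj. Qed.

Lemma at3E U p :
  U p = at3 U (val (src (fst3 p))) (val (tgt (fst3 p)))
              (val (tgt (mid3 p))) (val (tgt (lst3 p))).
Proof. by rewrite /at3 (ext0E _ p) //; exact: nodes3_inj. Qed.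

Lemma at1_fun (w : Omega1) (G : nat -> nat -> F) x y :
  (forall p, w p = G (val (src p)) (val (tgt p))) ->
  at1 w x y = (step x y)%:R * G x y.
Proof.
move=> wG; have [/step_ex[p [<- <-]]|nxy] := boolP (step x y).
  by rewrite -at1E wG mul1r.
rewrite mul0r; apply: ext0_out => -[p [ex ey]].
by case/negP: nxy; rewrite -ex -ey step_arrow.
Qed.

(** A formula on genuine paths says nothing about other triples; these lie outside the image of
    [nodes2], and the indicator supplies their zero. *)
Lemma at2_fun (u : Omega2) (G : nat -> nat -> nat -> F) x y z :
  (forall p, u p = G (val (src (fst2 p))) (val (tgt (fst2 p)))
                     (val (tgt (snd2 p)))) ->
  at2 u x y z = (step x y && step y z)%:R * G x y z.
Proof.
move=> uG; have [/andP[xy yz]|nxy] := boolP (step x y && step y z).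
  have [p [<- <-] [_ <-]] := step2_ex xy yz.
  by rewrite -at2E uG mul1r.
rewrite mul0r; apply: ext0_out => -[p [ex ey ez]].
by case/negP: nxy; rewrite -ex -ez -{1}ey step_arrow -ey -val_snd2 step_arrow.
Qed.

Lemma at3_fun (U : Omega3) (G : nat -> nat -> nat -> nat -> F) x y z w :
  (forall p, U p = G (val (src (fst3 p))) (val (tgt (fst3 p)))
                     (val (tgt (mid3 p))) (val (tgt (lst3 p)))) ->
  at3 U x y z w = [&& step x y, step y z & step z w]%:R * G x y z w.
Proof.
move=> UG; have [/and3P[xy yz zw]|nxy] := boolP [&& step x y, step y z & step z w].
  have [p [[<- <-] [_ <-] [_ <-]]] := step3_ex xy yz zw.
  by rewrite -at3E UG mul1r.
rewrite mul0r; apply: ext0_out => -[p [ex ey ez ew]].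
case/negP: nxy; rewrite -ex -ew -{1}ey step_arrow -ey -{1}ez -val_mid3 step_arrow.
by rewrite -ez -val_lst3 step_arrow.
Qed.

Lemma at1_step w x y : at1 w x y = (step x y)%:R * at1 w x y.
Proof. by apply: at1_fun => p; exact: at1E. Qed.

Lemma at2_step u x y z : at2 u x y z = (step x y && step y z)%:R * at2 u x y z.
Proof. by apply: at2_fun => p; exact: at2E. Qed.

(** The two factors vanish off the edges by themselves, so no indicator remains. *)
Lemma at2_tens w e x y z : at2 (tens w e) x y z = at1 w x y * at1 e y z.
Proof.
rewrite (at2_fun (G := fun x y z => at1 w x y * at1 e y z)).
  by rewrite (at1_step w) (at1_step e); do 2!case: step;
    rewrite /= ?(mul0r, mulr0, mul1r).
by move=> p; rewrite /tens !at1E val_snd2.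
Qed.

Lemma at3_tensl w u x y z t : at3 (tensl w u) x y z t = at1 w x y * at2 u y z t.
Proof.
rewrite (at3_fun (G := fun x y z t => at1 w x y * at2 u y z t)).
  by rewrite (at1_step w) (at2_step u); do 3!case: step;
    rewrite /= ?(mul0r, mulr0, mul1r).
by move=> p; rewrite /tensl at1E at2E /= val_mid3.
Qed.

Lemma at3_tensr u w x y z t : at3 (tensr u w) x y z t = at2 u x y z * at1 w z t.
Proof.
rewrite (at3_fun (G := fun x y z t => at2 u x y z * at1 w z t)).
  by rewrite (at1_step w) (at2_step u); do 3!case: step;
    rewrite /= ?(mul0r, mulr0, mul1r).
by move=> p; rewrite /tensr at1E at2E /= val_lst3.
Qed.

Lemma at2_lact2 f u (v : vertex) y z :
  at2 (lact2 f u) (val v) y z = f v * at2 u (val v) y z.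
Proof.
have [/andP[xy yz]|nxy] := boolP (step (val v) y && step y z); last first.
  by rewrite at2_step [in RHS]at2_step (negPf nxy) !mul0r mulr0.
have [p [/val_inj e1 <-] [_ <-]] := step2_ex xy yz.
by rewrite -e1 -!at2E.
Qed.

Lemma at2_ract2 f u x y (v : vertex) :
  at2 (ract2 u f) x y (val v) = at2 u x y (val v) * f v.
Proof.
have [/andP[xy yz]|nxy] := boolP (step x y && step y (val v)); last first.
  by rewrite at2_step [in RHS]at2_step (negPf nxy) !mul0r.
have [p [<- <-] [_ /val_inj e1]] := step2_ex xy yz.
by rewrite -e1 -!at2E.
Qed.

Lemma at2_linear a u v x y z :
  at2 (a *: u + v) x y z = a * at2 u x y z + at2 v x y z.
Proof. exact: ext0_linear. Qed.

Lemma at3_linear a u v x y z t :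
  at3 (a *: u + v) x y z t = a * at3 u x y z t + at3 v x y z t.
Proof. exact: ext0_linear. Qed.

Lemma at2D u v x y z : at2 (u + v) x y z = at2 u x y z + at2 v x y z.
Proof. by rewrite -[u]scale1r at2_linear mul1r scale1r. Qed.

Lemma at2N u x y z : at2 (- u) x y z = - at2 u x y z.
Proof. by rewrite /at2 /ext0; case: pselect => // _; rewrite oppr0. Qed.

Lemma at2Z a u x y z : at2 (a *: u) x y z = a * at2 u x y z.
Proof.
have := at2_linear a u 0 x y z; rewrite addr0 => ->.
have -> : at2 0 x y z = 0 by rewrite (at2_fun (G := fun _ _ _ => 0)) ?mulr0.
by rewrite addr0.
Qed.
End Coordinates.

(** Meant for goals in which the shape of the path is fixed, so that linear arithmetic settles each
    test on vertex numbers. *)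
Ltac decide_nat :=
  repeat match goal with
  | |- context [@eq_op ?T ?a ?b] =>
      first [rewrite (_ : (a == b) = true); [|by lia]
            |rewrite (_ : (a == b) = false); [|by lia]]
  | |- context [leq ?a ?b] =>
      first [rewrite (_ : leq a b = true); [|by lia]
            |rewrite (_ : leq a b = false); [|by lia]]
  | |- context [andb ?a ?b] => rewrite (_ : andb a b = false); [|by lia]
  end; rewrite /= ?(andbF, andbT) /= ?(mulr1n, mulr0n).

(** * Linear maps as plain functions *)

Section Linear.
Variable F : fieldType.

Lemma linearB_of (V W : lmodType F) (f : V -> W) : linear f ->
  forall u v, f (u - v) = f u - f v.
Proof. by move=> lf u v; rewrite addrC -scaleN1r lf scaleN1r addrC. Qed.

Lemma linear_sub (V W : lmodType F) (f g : V -> W) :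
  linear f -> linear g -> linear (fun v => f v - g v).
Proof. by move=> lf lg a u v; rewrite lf lg scalerBr opprD addrACA. Qed.

Lemma linear_comp (U V W : lmodType F) (f : V -> W) (g : U -> V) :
  linear f -> linear g -> linear (fun v => f (g v)).
Proof. by move=> lf lg a u v; rewrite lg lf. Qed.
End Linear.

(** * Formal sums and basis paths in coordinates *)

Section Fsum.
Variables (F : fieldType).

(** One path meets at most one term of each formal sum used here. The factor handles [k = 0], which
    is no index of the sum and arises as the predecessor of vertex 1. *)
Lemma fsum_single (P : Type) (w : nat -> P -> F^o) p k :
  (forall i, (0 < i)%N -> i != k -> w i p = 0) ->
  fsum w p = (0 < k)%N%:R * w k p.
Proof.
move=> w0; rewrite /fsum; case: (posnP k) => [k0|k_gt0] /=.
  rewrite mul0r fsbig1 // => i /= i0.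
  by apply: w0 => //; rewrite k0 -lt0n.
rewrite mul1r -(fsbig_widen [set k]%classic) ?fsbig_set1 //.
  by move=> i /= ->.
by move=> i /= [i0 /eqP ik]; exact: w0.
Qed.

Lemma thetaE p : theta F p = 1.
Proof.
have /and3P[x0 y0 xy] := step_arrow p.
(* The edge between two neighbours carries the index of the smaller one. *)
rewrite /theta (fsum_single (k := minn (val (src p)) (val (tgt p)))) => [|i i0 ik];
  rewrite addrfctE /ar /ar'.
  move: (val (src p)) (val (tgt p)) x0 y0 xy => x y x0 y0 /orP[] /eqP e; subst; decide_nat.
    by rewrite mul1r addr0.
  by rewrite mul1r add0r.
move: (val (src p)) (val (tgt p)) ik x0 y0 xy => x y ik x0 y0 xy.
have -> : (x == i) && (y == i.+1) = false by lia.
have -> : (x == i.+1) && (y == i) = false by lia.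
by rewrite addr0.
Qed.

Lemma at1_theta x y : at1 (theta F) x y = (step x y)%:R.
Proof. by rewrite (at1_fun (G := fun _ _ => 1)) ?mulr1 // => p; exact: thetaE. Qed.

Lemma at1_ar i x y : (0 < i)%N ->
  at1 (ar F i) x y = ((x == i) && (y == i.+1))%:R.
Proof.
move=> i0; rewrite (at1_fun (G := fun x y => ((x == i) && (y == i.+1))%:R)) //.
by rewrite -natrM mulnb /step; congr (nat_of_bool _)%:R; lia.
Qed.

Lemma at1_ar' i x y : (0 < i)%N ->
  at1 (ar' F i) x y = ((x == i.+1) && (y == i))%:R.
Proof.
move=> i0; rewrite (at1_fun (G := fun x y => ((x == i.+1) && (y == i))%:R)) //.
by rewrite -natrM mulnb /step; congr (nat_of_bool _)%:R; lia.
Qed.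

Lemma at2_ar_ar i j x y z : (0 < i)%N -> (0 < j)%N ->
  at2 (tens (ar F i) (ar F j)) x y z
  = [&& x == i, y == i.+1, y == j & z == j.+1]%:R.
Proof. by move=> i0 j0; rewrite at2_tens !at1_ar // -natrM mulnb -andbA. Qed.

Lemma at2_ar'_ar' i j x y z : (0 < i)%N -> (0 < j)%N ->
  at2 (tens (ar' F i) (ar' F j)) x y z
  = [&& x == i.+1, y == i, y == j.+1 & z == j]%:R.
Proof. by move=> i0 j0; rewrite at2_tens !at1_ar' // -natrM mulnb -andbA. Qed.

Lemma at2_ar_ar' i x y z : (0 < i)%N ->
  at2 (tens (ar F i) (ar' F i)) x y z = [&& x == i, y == i.+1 & z == i]%:R.
Proof.
move=> i0; rewrite at2_tens at1_ar // at1_ar' // -natrM mulnb.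
by congr (nat_of_bool _)%:R; lia.
Qed.

Lemma at2_ar'_ar i x y z : (0 < i)%N ->
  at2 (tens (ar' F i) (ar F i)) x y z = [&& x == i.+1, y == i & z == i.+1]%:R.
Proof.
move=> i0; rewrite at2_tens at1_ar // at1_ar' // -natrM mulnb.
by congr (nat_of_bool _)%:R; lia.
Qed.
End Fsum.

(** * The inverse of a metric supported on loops *)

Section Metric.
Variables (F : fieldType) (g : path2 -> F^o) (G : nat -> nat -> F).
Hypothesis gG : forall x y z,
  at2 g x y z = (step x y && (z == x))%:R * G x y.
Hypothesis G_neq0 : forall x y, step x y -> G x y != 0.

(** The loop [x -> y -> x] is weighted by the inverse coefficient of [y -> x -> y], because
    contracting a form on [x -> y] with the metric meets that loop. At vertex 1 the second term is
    0, as there is no step to 0. *)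
Definition inverse_metric (u : path2 -> F^o) : vertex -> F^o := fun v =>
  let x := val v in
  (G x.+1 x)^-1 * at2 u x x.+1 x + (G x.-1 x)^-1 * at2 u x x.-1 x.

Definition inverse_metric_id (U : path3 -> F^o) : arrow -> F^o := fun p =>
  let x := val (src p) in let y := val (tgt p) in
  (G x.+1 x)^-1 * at3 U x x.+1 x y + (G x.-1 x)^-1 * at3 U x x.-1 x y.

Definition id_inverse_metric (U : path3 -> F^o) : arrow -> F^o := fun p =>
  let x := val (src p) in let y := val (tgt p) in
  (G y.+1 y)^-1 * at3 U x y y.+1 y + (G y.-1 y)^-1 * at3 U x y y.-1 y.

Lemma loop_metric : metric g.
Proof.
exists inverse_metric, inverse_metric_id, id_inverse_metric; split; [|split].
- split=> [a u v|f u x|u f x].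
  + apply/funext => x.
    change (inverse_metric (a *: u + v) x
            = a * inverse_metric u x + inverse_metric v x :> F).
    by rewrite /inverse_metric !at2_linear; ring.
  + by rewrite /inverse_metric !at2_lact2; ring.
  + by rewrite /inverse_metric !at2_ract2; ring.
- split=> [a u v|u e|a u v|e u].
  + apply/funext => x.
    change (inverse_metric_id (a *: u + v) x
            = a * inverse_metric_id u x + inverse_metric_id v x :> F).
    by rewrite /inverse_metric_id !at3_linear; ring.
  + apply/funext => p; rewrite /inverse_metric_id /lact1 /inverse_metric.
    by rewrite !at3_tensr at1E; ring.
  + apply/funext => x.
    change (id_inverse_metric (a *: u + v) x
            = a * id_inverse_metric u x + id_inverse_metric v x :> F).
    by rewrite /id_inverse_metric !at3_linear; ring.
  + apply/funext => p; rewrite /id_inverse_metric /ract1 /inverse_metric.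
    by rewrite !at3_tensl at1E; ring.
- move=> w; split; apply/funext => p;
    rewrite [RHS]at1E ?/inverse_metric_id ?/id_inverse_metric;
    have st := step_arrow p; move: (val (src p)) (val (tgt p)) st => x y st;
    have /and3P[x0 y0 xy] := st;
    have st' : step y x by (rewrite /step x0 y0 orbC).
  (* On [x -> y] only the term with intermediate vertex [y] survives; the loop through the other
     neighbour of [x] does not end at [y]. *)
  + rewrite !at3_tensl !gG; case/orP: xy => /eqP e; subst.
      rewrite st' eqxx [x.+1 == x.-1](_ : _ = false) ?andbF; last by lia.
      by rewrite mul1r mul0r !mulr0 addr0 mulrCA mulVf ?mulr1 ?G_neq0.
    rewrite succnK st' eqxx [y == y.+2](_ : _ = false) ?andbF; last by lia.
    by rewrite mul1r mul0r !mulr0 add0r mulrCA mulVf ?mulr1 ?G_neq0.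
  + rewrite !at3_tensr !gG st; case/orP: xy => /eqP e; subst.
      rewrite succnK eqxx [x.+2 == x](_ : _ = false); last by lia.
      by rewrite mul1r !mul0r mulr0 add0r mulKf ?G_neq0.
    rewrite eqxx [y.-1 == y.+1](_ : _ = false); last by lia.
    by rewrite mul1r !mul0r mulr0 addr0 mulKf ?G_neq0.
Qed.
End Metric.

(** * The edge metric in coordinates *)

Section EdgeMetric.
Variables (F : fieldType) (h : nat -> F) (eps phi1 : F).

(** The coefficient of the loop [x -> y -> x], whose edge has index [x] when the loop starts upwards
    and [y] when it starts downwards. *)
Definition edge_coef x y : F := if y == x.+1 then h x * phi phi1 x else eps * h y.

Lemma at2_edge_metric x y z :
  at2 (edge_metric h eps phi1) x y z
  = (step x y && (z == x))%:R * edge_coef x y.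
Proof.
rewrite (at2_fun (G := fun x y z => (z == x)%:R * edge_coef x y)).
  rewrite mulrA -natrM mulnb; congr ((nat_of_bool _)%:R * _).
  by case: eqP => [->|_]; rewrite ?andbF // /step; lia.
have scE (a b : F) : a *: (b : F^o) = a * b by [].
move=> {x y z} p; have /and3P[x0 y0 xy] := step_arrow (fst2 p).
rewrite /edge_metric /edge_coef.
rewrite (fsum_single (k := minn (val (src (fst2 p))) (val (tgt (fst2 p)))))
    => [|i i0 ik]; rewrite !(addrfctE, scalrfctE) /tens /ar /ar' val_snd2.
  move: (val (src (fst2 p))) (val (tgt (fst2 p))) (val (tgt (snd2 p))) x0 y0 xy
    => x y z x0 y0 /orP[] /eqP e; subst; decide_nat.
    rewrite (_ : minn x x.+1 = x); last by lia.
    by rewrite !scE; ring.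
  rewrite (_ : minn y.+1 y = y); last by lia.
  by rewrite !scE; ring.
move: (val (src (fst2 p))) (val (tgt (fst2 p))) (val (tgt (snd2 p))) ik xy
  => x y z ik xy.
have -> : (x == i) && (y == i.+1) = false by lia.
have -> : (x == i.+1) && (y == i) = false by lia.
by rewrite !mul0r !scaler0 addr0 scaler0.
Qed.
End EdgeMetric.

(** * The braiding, its connection and the Leibniz rules *)

Section Braiding.
Variables (F : fieldType) (t t' sg sg' : nat -> F).
Local Notation Omega1 := (arrow -> F^o).
Local Notation Omega2 := (path2 -> F^o).
Local Notation Omega3 := (path3 -> F^o).
Local Notation theta := (theta F).

(* Coefficient of the path x -> y -> z in sigma(x -> y' -> z).  On loops sigma
   has diagonal entries t_x (via x+1) and t'_(x-1) (via x-1), and each other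
   entry of a column is 1 more than the diagonal one. *)
Definition braid_coef (x y z y' : nat) : F :=
  if z == x then (y != y')%:R + (if y' == x.+1 then t x else t' x.-1)
  else if (x < z)%N then sg x else sg' y.

(** A path from [x] has middle vertex [x.+1] or [x.-1], so the matrix of sigma acts through at most
    two terms; [at2] is 0 for those that are not paths. *)
Definition braid (u : Omega2) : Omega2 := fun p =>
  let x := val (src (fst2 p)) in
  let y := val (tgt (fst2 p)) in
  let z := val (tgt (snd2 p)) in
  braid_coef x y z x.+1 * at2 u x x.+1 z + braid_coef x y z x.-1 * at2 u x x.-1 z.

Definition braid_id (U : Omega3) : Omega3 := fun p =>
  let x := val (src (fst3 p)) in
  let y := val (tgt (fst3 p)) in
  let z := val (tgt (mid3 p)) in
  let w := val (tgt (lst3 p)) in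
  braid_coef x y z x.+1 * at3 U x x.+1 z w
  + braid_coef x y z x.-1 * at3 U x x.-1 z w.

Definition id_braid (U : Omega3) : Omega3 := fun p =>
  let x := val (src (fst3 p)) in
  let y := val (tgt (fst3 p)) in
  let z := val (tgt (mid3 p)) in
  let w := val (tgt (lst3 p)) in
  braid_coef y z w y.+1 * at3 U x y y.+1 w
  + braid_coef y z w y.-1 * at3 U x y y.-1 w.

Lemma at2_braid u x y z :
  at2 (braid u) x y z = (step x y && step y z)%:R *
    (braid_coef x y z x.+1 * at2 u x x.+1 z
     + braid_coef x y z x.-1 * at2 u x x.-1 z).
Proof.
exact: (at2_fun (G := fun x y z => braid_coef x y z x.+1 * at2 u x x.+1 z
     + braid_coef x y z x.-1 * at2 u x x.-1 z)).
Qed.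

Lemma at3_id_braid U x y z w :
  at3 (id_braid U) x y z w = [&& step x y, step y z & step z w]%:R *
    (braid_coef y z w y.+1 * at3 U x y y.+1 w
     + braid_coef y z w y.-1 * at3 U x y y.-1 w).
Proof.
exact: (at3_fun (G := fun x y z w => braid_coef y z w y.+1 * at3 U x y y.+1 w
     + braid_coef y z w y.-1 * at3 U x y y.-1 w)).
Qed.

Lemma braid_linear : linear braid.
Proof.
move=> a u v; apply/funext => p.
change (braid (a *: u + v) p = a * braid u p + braid v p :> F).
by rewrite /braid !at2_linear; ring.
Qed.

Lemma braid_id_linear : linear braid_id.
Proof.
move=> a u v; apply/funext => p.
change (braid_id (a *: u + v) p = a * braid_id u p + braid_id v p :> F).
by rewrite /braid_id !at3_linear; ring.
Qed.

Lemma id_braid_linear : linear id_braid.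
Proof.
move=> a u v; apply/funext => p.
change (id_braid (a *: u + v) p = a * id_braid u p + id_braid v p :> F).
by rewrite /id_braid !at3_linear; ring.
Qed.

Lemma braid_bimodule : bimodule_map braid.
Proof.
split=> [|f u|u f]; first exact: braid_linear.
- by apply/funext => p; rewrite /lact2 /braid -/(lact2 f u) !at2_lact2; ring.
- by apply/funext => p; rewrite /ract2 /braid -/(ract2 u f) !at2_ract2; ring.
Qed.

Lemma braid_id_tensr u e : braid_id (tensr u e) = tensr (braid u) e.
Proof.
apply/funext => p; rewrite /braid_id !at3_tensr [RHS]at3E at3_tensr at2_braid.
have := step_arrow (lst3 p); have := step_arrow (mid3 p).
have := step_arrow (fst3 p); rewrite val_mid3 val_lst3 => -> -> _.
by rewrite mul1r; ring.
Qed.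

Lemma id_braid_tensl w u : id_braid (tensl w u) = tensl w (braid u).
Proof.
apply/funext => p; rewrite /id_braid !at3_tensl [RHS]at3E at3_tensl at2_braid.
have := step_arrow (lst3 p); have := step_arrow (mid3 p).
rewrite val_mid3 val_lst3 => -> ->.
by rewrite mul1r; ring.
Qed.

Definition conn (w : Omega1) : Omega2 := tens theta w - braid (tens w theta).

(* The terms sigma(w (x) theta) (x) e cancel in the tensor product connection,
   which leaves theta (x) u - (sigma (x) id)(id (x) sigma)(u (x) theta). *)
Definition conn2 (u : Omega2) : Omega3 :=
  tensl theta u - braid_id (id_braid (tensr u theta)).

Lemma tensr_linear (e : Omega1) : linear (fun u : Omega2 => tensr u e : Omega3).
Proof.
move=> a u v; apply/funext => p.
by change ((a * u (init3 p) + v (init3 p)) * e (lst3 p)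
  = a * (u (init3 p) * e (lst3 p)) + v (init3 p) * e (lst3 p) :> F); ring.
Qed.

Lemma tensl_linear (e : Omega1) : linear (fun u : Omega2 => tensl e u : Omega3).
Proof.
move=> a u v; apply/funext => p.
by change (e (fst3 p) * (a * u (tail3 p) + v (tail3 p))
  = a * (e (fst3 p) * u (tail3 p)) + e (fst3 p) * v (tail3 p) :> F); ring.
Qed.

Lemma tens_linearl (e : Omega1) : linear (fun u : Omega1 => tens u e : Omega2).
Proof.
move=> a u v; apply/funext => p.
by change ((a * u (fst2 p) + v (fst2 p)) * e (snd2 p)
  = a * (u (fst2 p) * e (snd2 p)) + v (fst2 p) * e (snd2 p) :> F); ring.
Qed.

Lemma tens_linearr (e : Omega1) : linear (fun u : Omega1 => tens e u : Omega2).
Proof.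
move=> a u v; apply/funext => p.
by change (e (fst2 p) * (a * u (snd2 p) + v (snd2 p))
  = a * (e (fst2 p) * u (snd2 p)) + e (fst2 p) * v (snd2 p) :> F); ring.
Qed.

Lemma tensA (u v w : Omega1) : tensr (tens u v) w = tensl u (tens v w).
Proof. by apply/funext => p; rewrite /tensr /tensl /tens /= mulrA. Qed.

Lemma conn2P : tensor_connection conn braid conn2.
Proof.
split.
  apply: linear_sub; first exact: tensl_linear.
  apply: linear_comp; first exact: braid_id_linear.
  apply: linear_comp; first exact: id_braid_linear.
  exact: tensr_linear.
exists braid_id; first by split; [exact: braid_id_linear|exact: braid_id_tensr].
(* Associativity and [id_braid_tensl] identify [id (x) sigma] on [(w (x) e) (x) theta] with
   [w (x) sigma(e (x) theta)], the term that [conn e] contributes. *)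
move=> w e; rewrite /conn2 /conn tensA id_braid_tensl.
rewrite (linearB_of (tensr_linear e)) (linearB_of (tensl_linear w)).
rewrite (linearB_of braid_id_linear) -!tensA -braid_id_tensr.
by rewrite addrA subrK.
Qed.

(** Every coefficient of [theta] is 1, so [d0 f = theta f - f theta]. The bimodule property of
    [braid] turns this into both Leibniz rules. *)
Lemma connP : bimodule_connection conn braid.
Proof.
have [bl blact bract] := braid_bimodule.
split.
- apply: linear_sub; first exact: tens_linearr.
  apply: linear_comp; first exact: braid_linear.
  exact: tens_linearl.
- exact: braid_bimodule.
- move=> f w; rewrite /conn.
  have -> : tens (lact1 f w) theta = lact2 f (tens w theta).
    by apply/funext => p; rewrite /tens /lact1 /lact2 mulrA.
  rewrite blact; apply/funext => p.
  change (theta (fst2 p) * (f (src (snd2 p)) * w (snd2 p))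
          - f (src (fst2 p)) * braid (tens w theta) p
          = (f (tgt (fst2 p)) - f (src (fst2 p))) * w (snd2 p)
          + f (src (fst2 p)) * (theta (fst2 p) * w (snd2 p)
          - braid (tens w theta) p) :> F).
  by rewrite thetaE -(eqP (path2_comp p)); ring.
- move=> w f; rewrite /conn.
  (* Moving [f] past [theta] costs [tens w (d0 f)]; [conn] subtracts [braid], so this term returns
     with a plus sign. *)
  have -> : tens (ract1 w f) theta = ract2 (tens w theta) f - tens w (d0 f).
    apply/funext => p.
    change (w (fst2 p) * f (tgt (fst2 p)) * theta (snd2 p)
      = w (fst2 p) * theta (snd2 p) * f (tgt (snd2 p))
        - w (fst2 p) * (f (tgt (snd2 p)) - f (src (snd2 p))) :> F).
    by rewrite thetaE -(eqP (path2_comp p)); ring.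
  rewrite (linearB_of bl) bract; apply/funext => p.
  change (theta (fst2 p) * (w (snd2 p) * f (tgt (snd2 p)))
    - (braid (tens w theta) p * f (tgt (snd2 p)) - braid (tens w (d0 f)) p)
    = (theta (fst2 p) * w (snd2 p) - braid (tens w theta) p) * f (tgt (snd2 p))
      + braid (tens w (d0 f)) p :> F).
  by ring.
Qed.
End Braiding.

(** * The wedge relations in coordinates, and torsion freeness *)

Section FsumPaths.
Variable F : fieldType.
Implicit Types (b : nat -> F) (p : path2).

Lemma fsum_ar_ar b p (x := val (src (fst2 p))) (y := val (tgt (fst2 p)))
    (z := val (tgt (snd2 p))) :
  fsum (fun i => b i *: (tens (ar F i) (ar F i.+1) : path2 -> F^o)) p
  = ((y == x.+1) && (z == y.+1))%:R * b x.
Proof.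
have /and3P[x0 _ _] := step_arrow (fst2 p).
rewrite (fsum_single (k := x)) => [|i i0 ik];
  rewrite scalrfctE (at2E (tens _ _)) at2_ar_ar //.
  rewrite x0 mul1r -/x -/y -/z eqxx /= [RHS]mulrC; congr (b x * (nat_of_bool _)%:R).
  by lia.
by rewrite -/x eq_sym (negPf ik) scaler0.
Qed.

Lemma fsum_ar'_ar' b p (x := val (src (fst2 p))) (y := val (tgt (fst2 p)))
    (z := val (tgt (snd2 p))) :
  fsum (fun i => b i *: (tens (ar' F i.+1) (ar' F i) : path2 -> F^o)) p
  = ((x == y.+1) && (y == z.+1))%:R * b z.
Proof.
have /and3P[_ z0 _] := step_arrow (snd2 p).
rewrite (fsum_single (k := z)) => [|i i0 ik];
  rewrite scalrfctE (at2E (tens _ _)) at2_ar'_ar' //.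
  rewrite z0 mul1r -/x -/y -/z eqxx /= [RHS]mulrC; congr (b z * (nat_of_bool _)%:R).
  by lia.
rewrite -/x -/y -/z (_ : [&& _, _, _ & _] = false) ?scaler0 //; lia.
Qed.

Lemma fsum_loops b p (x := val (src (fst2 p))) (y := val (tgt (fst2 p)))
    (z := val (tgt (snd2 p))) :
  fsum (fun i => b i *: (tens (ar F i.+1) (ar' F i.+1)
                         + tens (ar' F i) (ar F i) : path2 -> F^o)) p
  = [&& 1 < x, z == x & (y == x.+1) || (x == y.+1)]%N%:R * b x.-1.
Proof.
have st := step_arrow (fst2 p).
(* Both loops of term [i] are based at [i.+1], hence the index [x.-1]. For [x = 1] it is 0 and the
   sum vanishes; the loop at vertex 1 has its own relation in the wedge quotient. *)
rewrite (fsum_single (k := x.-1)) => [|i i0 ik];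
  rewrite scalrfctE addrfctE (at2E (tens (ar F _) _)) (at2E (tens (ar' F _) _)).
  have [x1|x1] := ltnP 1 x; last first.
    by rewrite (_ : (0 < x.-1)%N = false) ?mul0r //; lia.
  rewrite at2_ar_ar' // at2_ar'_ar; last by lia.
  rewrite -/x -/y -/z (_ : x.-1.+1 = x) ?eqxx; last by lia.
  rewrite (_ : (0 < x.-1)%N = true) ?mul1r; last by lia.
  rewrite (_ : (y == x.-1) = (x == y.+1)); last by lia.
  rewrite [RHS]mulrC -natrD; congr (b _ * _%:R).
  by case: (z == x); rewrite ?andbF // !andbT /=; case: eqP => //= ->; lia.
rewrite at2_ar_ar' // at2_ar'_ar // -/x -/y -/z.
have -> : [&& x == i.+1, y == i.+2 & z == i.+1] = false by lia.
have -> : [&& x == i.+1, y == i & z == i.+1] = false by lia.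
by rewrite addr0 scaler0.
Qed.
End FsumPaths.

Section Torsion.
Variables (F : fieldType) (t t' sg sg' : nat -> F).
Local Notation braid := (braid t t' sg sg').
Local Notation conn := (conn t t' sg sg').

Lemma conn_torsion_free : torsion_free conn.
Proof.
move=> w; rewrite /eq_wedge; set u := tens w (theta F).
set M : path2 -> F^o := conn w - d1 w.
(* The terms [tens theta w] cancel, which leaves [- (sigma + 1)] applied to [u]. *)
have ME x y z : at2 M x y z = - (at2 (braid u) x y z + at2 u x y z).
  have -> : M = - (braid u + u) :> (path2 -> F^o).
    rewrite /M /conn /d1 -/u; apply/funext => p.
    change (tens (theta F) w p - braid u p - (tens (theta F) w p + u p)
            = - (braid u p + u p) :> F).
    by ring.
  by rewrite at2N at2D.
(* Each relation takes the coefficient of the difference on its own path; a pair of loops takes the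
   one on the upper loop [i.+1 -> i.+2 -> i.+1]. *)
exists (fun i => at2 M i i.+1 i.+2), (fun i => at2 M i.+2 i.+1 i),
  (fun i => at2 M i.+1 i.+2 i.+1), (at2 M 1 2 1).
apply/funext => p; rewrite [LHS]at2E; clearbody M.
rewrite !addrfctE fsum_ar_ar fsum_ar'_ar' fsum_loops scalrfctE.
rewrite (at2E (tens _ _)) at2_ar_ar' //.
have := step_arrow (fst2 p); have := step_arrow (snd2 p); rewrite val_snd2.
move: (val (src (fst2 p))) (val (tgt (fst2 p))) (val (tgt (snd2 p)))
  => {p} x y z yz xy; have /and3P[_ z0] := yz; have /and3P[x0 y0] := xy.
have scE (a b : F) : a *: (b : F^o) = a * b by [].
case/orP=> /eqP xyE /orP[] /eqP yzE; subst; rewrite ?scE; decide_nat.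
- by ring.
- have zx : z = x by lia.
  subst z; have [->|x1] := eqVneq x 1%N; decide_nat; first by ring.
  rewrite (_ : x.-1.+1 = x); last by lia.
  by ring.
(* The coefficient on the lower loop has to agree with the witness read off the upper loop; here the
   equal column entries of [sigma + 1] enter. *)
- case: y y0 {xy yz x0 z0} => // n _; decide_nat.
  rewrite !ME !at2_braid /step /braid_coef; decide_nat; ring.
- by ring.
Qed.
End Torsion.

(** * Values of the braiding on the basis paths *)

Section ConnectionCoefficients.
Variables (F : fieldType) (t t' sg sg' : nat -> F).
Local Notation braid := (braid t t' sg sg').
Local Notation conn := (conn t t' sg sg').

Lemma braid_eq (u v : path2 -> F^o) :
  (forall x y z, (0 < x)%N -> (0 < y)%N -> (0 < z)%N ->
     y = x.+1 \/ x = y.+1 -> z = y.+1 \/ y = z.+1 ->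
     braid_coef t t' sg sg' x y z x.+1 * at2 u x x.+1 z
     + braid_coef t t' sg sg' x y z x.-1 * at2 u x x.-1 z = at2 v x y z) ->
  braid u = v.
Proof.
move=> uv; apply/funext => p; rewrite [LHS]at2E [RHS]at2E at2_braid.
have yz := step_arrow (snd2 p); have xy := step_arrow (fst2 p).
rewrite val_snd2 in yz; rewrite xy yz mul1r.
case/and3P: xy => x0 y0 xy; case/and3P: yz => _ z0 yz.
by apply: uv => //; [case/orP: xy | case/orP: yz] => /eqP; [left|right|left|right].
Qed.

Ltac braid_cases xy yz :=
  case: xy => ?; case: yz => ?; subst;
  rewrite ?at2D !at2Z ?at2_ar_ar ?at2_ar'_ar' ?at2_ar_ar' ?at2_ar'_ar /braid_coef;
  try lia; decide_nat; try ring.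

Lemma conn_coefficients : has_coefficients t t' sg sg' conn braid.
Proof.
split; first by split; [exact: braid_bimodule|].
split=> [i i0|i i0||i i0|i i0]; apply: braid_eq => x y z x0 y0 z0 xy yz.
(* Sigma is applied to a single basis path; in each case, comparing the vertex that fixes its index
   decides the remaining tests. *)
- have [?|?] := eqVneq x i; braid_cases xy yz.
- have [?|?] := eqVneq y i; braid_cases xy yz.
- have [?|?] := eqVneq x 1%N; braid_cases xy yz.
- have [?|?] := eqVneq x i; braid_cases xy yz.
- have [?|?] := eqVneq x i.+1; braid_cases xy yz.
Qed.
End ConnectionCoefficients.

(** * Metric compatibility for arbitrary loop coefficients *)

Section Compatibility.
Variables (F : fieldType) (t t' sg sg' A B : nat -> F) (g : path2 -> F^o).
Hypothesis gE : forall x y z, at2 g x y z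
  = (step x y && (z == x))%:R * (if y == x.+1 then A x else B y).
Hypothesis udu1 : t 1%N * (t' 1%N * A 1%N) = B 1%N.
Hypothesis udu : forall i,
  t i.+2 * (t' i.+2 * A i.+2) + (1 + t' i.+1) * (sg i.+1 * B i.+1) = B i.+2.
Hypothesis duu : forall i,
  (1 + t i.+2) * (t' i.+2 * A i.+2) + t' i.+1 * (sg i.+1 * B i.+1) = 0.
Hypothesis uud : forall i, (0 < i)%N -> sg i * ((1 + t' i) * A i) = A i.+1.
Hypothesis udd : forall i,
  t i.+2 * (sg' i.+2 * A i.+2) + (1 + t' i.+1) * (t i.+1 * B i.+1) = 0.
Hypothesis dud : forall i,
  (1 + t i.+2) * (sg' i.+2 * A i.+2) + t' i.+1 * (t i.+1 * B i.+1) = A i.+1.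
Hypothesis ddu : forall i, sg' i.+2 * ((1 + t i.+2) * B i.+2) = B i.+1.

(** The eight words in up and down steps are treated separately. On [x -> y -> z -> w] the term
    [theta (x) g] contributes only if [w = y], and the two words of three equal steps give 0 on both
    sides. *)
Lemma conn_metric_compatible : metric_compatible g (conn t t' sg sg') (braid t t' sg sg').
Proof.
exists (conn2 t t' sg sg'); first exact: conn2P.
apply/funext => p.
change (tensl (theta F) g p
  - braid_id t t' sg sg' (id_braid t t' sg sg' (tensr g (theta F))) p = 0 :> F).
apply/eqP; rewrite subr_eq0; apply/eqP.
rewrite at3E at3_tensl at1_theta /braid_id !at3_id_braid !at3_tensr !at1_theta.
have xy := step_arrow (fst3 p); have yz := step_arrow (mid3 p).
have zw := step_arrow (lst3 p); rewrite val_mid3 in yz; rewrite val_lst3 in zw.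
move: (val (src (fst3 p))) (val (tgt (fst3 p))) (val (tgt (mid3 p)))
  (val (tgt (lst3 p))) xy yz zw => {p} x y z w.
move=> /and3P[x0 y0 xy] /and3P[_ z0 yz] /and3P[_ w0 zw].
rewrite !gE /step /braid_coef.
have {}xy : y = x.+1 \/ x = y.+1 by lia.
have {}yz : z = y.+1 \/ y = z.+1 by lia.
have {}zw : w = z.+1 \/ z = w.+1 by lia.
case: xy => xy; case: yz => yz; case: zw => zw.
- have [-> -> ->] : [/\ y = x.+1, z = x.+2 & w = x.+3] by split; lia.
  by decide_nat; ring.
- have [-> -> ->] : [/\ y = x.+1, z = x.+2 & w = x.+1] by split; lia.
  by decide_nat; rewrite -uud //; ring.
- have [-> -> ->] : [/\ y = x.+1, z = x & w = x.+1] by split; lia.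
  (* Vertex 1 has no lower neighbour, so there a single term is left: [udu1] in place of [udu]. *)
  case: x x0 {xy yz zw} => [//|[|n]] _; decide_nat.
    by rewrite -udu1; ring.
  by rewrite -udu; ring.
- have [-> -> ->] : [/\ x = w.+1, y = w.+2 & z = w.+1] by split; lia.
  case: w w0 {xy yz zw} => // n _; decide_nat.
  by transitivity (0 : F); [ring | rewrite -[LHS](udd n); ring].
- have [-> -> ->] : [/\ x = y.+1, z = y.+1 & w = y.+2] by split; lia.
  case: y y0 {xy yz zw} => // n _; decide_nat.
  by transitivity (0 : F); [ring | rewrite -[LHS](duu n); ring].
- have [-> -> ->] : [/\ x = y.+1, z = y.+1 & w = y] by split; lia.
  case: y y0 {xy yz zw} => // n _; decide_nat.
  by rewrite -(dud n); ring.
- have [-> -> ->] : [/\ x = z.+2, y = z.+1 & w = z.+1] by split; lia.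
  case: z z0 {xy yz zw} => // n _; decide_nat.
  by rewrite -(ddu n); ring.
- have [-> -> ->] : [/\ x = w.+3, y = w.+2 & z = w.+1] by split; lia.
  by decide_nat; ring.
Qed.
End Compatibility.

(** * The quantum geometry obtained from the recursion *)

Lemma edge_metric_geometry (F : fieldType) (h : nat -> F) (eps phi1 tau1 : F) :
  (forall i, (0 < i)%N -> h i != 0) -> eps = 1 \/ eps = -1 ->
  well_defined eps phi1 tau1 -> is_geometry h eps phi1 tau1.
Proof.
move=> h_neq0 epsE wd.
have eps2 : eps * eps = 1 by case: epsE => ->; ring.
have e0 : eps != 0 by apply: contra_eq_neq eps2 => ->; rewrite mul0r eq_sym oner_neq0.
have gE := at2_edge_metric h eps phi1.
split.
  apply: (loop_metric gE) => x y /and3P[x0 y0 _]; rewrite /edge_coef.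
  by have [f0 _ _ _] := wd _ x0; case: ifP => _; rewrite mulf_neq0 ?h_neq0.
set t := tau eps phi1 tau1; set t' := tau' eps phi1 tau1.
set sg := sigma h eps phi1 tau1; set sg' := sigma' h eps phi1 tau1.
exists (conn t t' sg sg'), (braid t t' sg sg').
split; first exact: conn_coefficients.
split; [exact: connP | exact: conn_torsion_free |].
(* The loop coefficients [A] and [B] are the upward and downward values of [edge_coef]. *)
apply: (@conn_metric_compatible _ _ _ _ _ (fun i => h i * phi phi1 i)
  (fun i => eps * h i)) => //.
- exact: compat_udu1.
- exact: compat_udu.
- exact: compat_duu.
- exact: compat_uud.
- exact: compat_udd.
- exact: compat_dud.
- exact: compat_ddu.
Qed.

(** * Closed formulas for the canonical initial values *)

Section Canonical.
Variables (F : numFieldType) (h : nat -> F) (s : F).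
Hypothesis h_neq0 : forall i, (0 < i)%N -> h i != 0.
Hypothesis s2 : s * s = 1.

Lemma phi_canonical i : phi (2 : F) i.+1 = i.+2%:R / i.+1%:R.
Proof.
elim: i => [|i IH]; first by rewrite divr1.
have a0 : i.+1%:R != 0 :> F by rewrite pnatr_eq0.
have b0 : i.+2%:R != 0 :> F by rewrite pnatr_eq0.
rewrite phiS IH -[i.+3%:R]natr1; move: b0; rewrite -[i.+2%:R]natr1.
by move: (i.+1%:R) a0 => a a0 b0; field; rewrite a0 b0.
Qed.

Lemma sign_canonical i : (s * (-1) ^+ i) * (s * (-1) ^+ i) = 1.
Proof. by rewrite mulrACA s2 mul1r -expr2 sqrr_sign. Qed.

(** A square root of 1 cannot be [- n.+2%:R], whose square is a natural number other than 1. For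
    [u = s * (-1) ^+ i] this keeps both [phi + tau] and [1 + tau'] away from 0. *)
Lemma natr_add_sign_neq0 n (u : F) : u * u = 1 -> n.+2%:R + u != 0.
Proof.
move=> u2; apply/eqP => nu.
have uE : u = - n.+2%:R by apply/eqP; rewrite -addr_eq0 addrC nu.
have : n.+2%:R * n.+2%:R == 1 :> F by rewrite -mulrNN -uE u2.
by rewrite -natrM pnatr_eq1.
Qed.

Lemma tau_canonical i : tau 1 2 s i.+1 = s * (-1) ^+ i / i.+1%:R.
Proof.
elim: i => [|i IH]; first by rewrite expr0 mulr1 divr1.
have u2 := sign_canonical i; rewrite tauS IH !phi_canonical exprS mulN1r mulrN.
move: (s * _) u2 => u u2.
have d0 := natr_add_sign_neq0 i u2.
have a0 : i.+1%:R != 0 :> F by rewrite pnatr_eq0.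
have b0 : i.+2%:R != 0 :> F by rewrite pnatr_eq0.
rewrite -[i.+3%:R]natr1; move: b0 d0; rewrite -[i.+2%:R]natr1.
move: (i.+1%:R) a0 => a a0 b0 d0.
apply/eqP; rewrite -subr_eq0; apply/eqP.
(* With [a] for [i.+1] and [u] for the sign, the two sides differ by a multiple of [u * u - 1]:
   [field] verifies this difference, and [u * u = 1] makes it 0. *)
transitivity ((u * u - 1) / ((a + 1) * (a + 1 + u))).
  by field; rewrite a0 b0 d0.
by rewrite u2 subrr mul0r.
Qed.

Lemma tau_canonicalS i :
  tau 1 2 s i.+2 = - (s * (-1) ^+ i) / (i.+1%:R + 1).
Proof. by rewrite tau_canonical exprS mulN1r mulrN natr1. Qed.

Lemma tau'_canonical i : tau' 1 2 s i.+1 = - tau 1 2 s i.+2.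
Proof.
rewrite /tau' tau_canonicalS tau_canonical !phi_canonical.
have u2 := sign_canonical i; move: (s * _) u2 => u u2.
have u0 : u != 0 by apply: contra_eq_neq u2 => ->; rewrite mul0r eq_sym oner_neq0.
have a0 : i.+1%:R != 0 :> F by rewrite pnatr_eq0.
have b0 : i.+2%:R != 0 :> F by rewrite pnatr_eq0.
rewrite -[i.+3%:R]natr1; move: b0; rewrite -[i.+2%:R]natr1.
move: (i.+1%:R) a0 => a a0 b0.
apply/eqP; rewrite -subr_eq0; apply/eqP.
transitivity ((1 - u * u) / ((a + 1) * u)); first by field; rewrite u0 a0 b0.
by rewrite u2 subrr mul0r.
Qed.

Lemma well_defined_canonical : well_defined 1 2 s.
Proof.
case=> // i _; rewrite tau'_canonical tau_canonicalS tau_canonical phi_canonical.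
have u2 := sign_canonical i; move: (s * _) u2 => u u2.
have d0 := natr_add_sign_neq0 i u2.
have u0 : u != 0 by apply: contra_eq_neq u2 => ->; rewrite mul0r eq_sym oner_neq0.
have a0 : i.+1%:R != 0 :> F by rewrite pnatr_eq0.
have b0 : i.+2%:R != 0 :> F by rewrite pnatr_eq0.
split; rewrite ?mulf_neq0 ?invr_neq0 //.
  by rewrite mul1r -mulrDl mulf_neq0 ?invr_neq0.
(* Here [1 + tau'] equals [(i.+2%:R + u) / i.+2%:R]. *)
rewrite natr1 mulNr opprK; apply: contraNneq d0 => e.
have -> : i.+2%:R + u = i.+2%:R * (1 + u / i.+2%:R).
  by rewrite mulrDr mulr1 mulrCA divff // mulr1.
by rewrite e mulr0.
Qed.

(** In closed form [phi_i (1 + tau'_i) = phi_i + tau_i], so the quotient in [sigma] is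
    [1 + tau_(i+1)] by the recursion. The direct comparison meets the same multiple of [u * u - 1]
    as [tau_canonical]. *)
Lemma sigma_canonical i :
  sigma h 1 2 s i.+1 = h i.+2 / h i.+1 * (1 + tau 1 2 s i.+2).
Proof.
rewrite /sigma tau'_canonical tau_canonicalS !phi_canonical.
have h1 := h_neq0 (ltn0Sn i).
have u2 := sign_canonical i; move: (s * _) u2 => u u2.
have d0 := natr_add_sign_neq0 i u2.
have a0 : i.+1%:R != 0 :> F by rewrite pnatr_eq0.
have b0 : i.+2%:R != 0 :> F by rewrite pnatr_eq0.
rewrite -[i.+3%:R]natr1; move: b0 d0; rewrite -[i.+2%:R]natr1.
move: (i.+1%:R) a0 => a a0 b0 d0.
apply/eqP; rewrite -subr_eq0; apply/eqP.
transitivity (h i.+2 / h i.+1 * ((u * u - 1) / ((a + 1) * (a + 1 + u)))).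
  by field; rewrite a0 b0 d0 h1.
by rewrite u2 subrr mul0r mulr0.
Qed.

(** The recursion reads [1 + tau_(i+1) = phi_(i+1) / (phi_i + tau_i)], and [sigma'] contains the
    inverse of this quotient. *)
Lemma sigma'_canonical i :
  sigma' h 1 2 s i.+2 = h i.+1 / h i.+2 * (1 / (1 + tau 1 2 s i.+2)).
Proof.
have [f1 _ P1 _] := well_defined_canonical (ltn0Sn i).
have [f2 _ _ _] := well_defined_canonical (ltn0Sn i.+1).
have h2 := h_neq0 (ltn0Sn i.+1).
by rewrite mul1r in P1; rewrite /sigma' succnK tauS addNKr; field; rewrite h2 f2 P1.
Qed.
End Canonical.

(** * Rationality of the coefficients *)

Section Rational.
Variable F : numFieldType.
Implicit Types x y : F.

Lemma rationalN x : is_rational x -> is_rational (- x).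
Proof. by case=> q ->; exists (- q); rewrite rmorphN. Qed.

Lemma rationalD x y : is_rational x -> is_rational y -> is_rational (x + y).
Proof. by case=> q -> [r ->]; exists (q + r); rewrite rmorphD. Qed.

Lemma rationalM x y : is_rational x -> is_rational y -> is_rational (x * y).
Proof. by case=> q -> [r ->]; exists (q * r); rewrite rmorphM. Qed.

(** The case [q = 0] is covered, as the inverse of 0 is 0 in both fields. *)
Lemma rationalV x : is_rational x -> is_rational x^-1.
Proof. by case=> q ->; exists q^-1; rewrite fmorphV. Qed.

Lemma rational_nat n : is_rational (n%:R : F).
Proof. by exists n%:R; rewrite rmorph_nat. Qed.
End Rational.

Section RationalCoefficients.
Variables (F : numFieldType) (h : nat -> F) (eps tau1 : F).
Hypothesis epsE : eps = 1 \/ eps = -1.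
Hypothesis h_rat : forall i, (0 < i)%N -> is_rational (h i).
Hypothesis tau1_rat : is_rational tau1.

Lemma eps_rational : is_rational eps.
Proof. by case: epsE => ->; [|apply: rationalN]; exact: (rational_nat _ 1). Qed.

Lemma phi_rational i : is_rational (phi (2 : F) i.+1).
Proof.
elim: i => [|i IH]; first exact: (rational_nat _ 2).
rewrite phiS; apply: rationalD; first exact: (rational_nat _ 2).
exact/rationalN/rationalV.
Qed.

Lemma tau_rational i : is_rational (tau eps 2 tau1 i.+1).
Proof.
elim: i => [//|i IH]; rewrite tauS.
apply: rationalD; first exact/rationalN/(rational_nat _ 1).
apply: rationalM; first exact: phi_rational.
by apply/rationalV/rationalD; [exact: phi_rational|exact: rationalM eps_rational IH].
Qed.

Lemma tau'_rational i : is_rational (tau' eps 2 tau1 i.+1).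
Proof.
apply: rationalM; first exact: eps_rational.
apply: rationalM; last exact/rationalV/tau_rational.
by apply: rationalD; [|apply: rationalN]; exact: phi_rational.
Qed.

Lemma sigma_rational i : is_rational (sigma h eps 2 tau1 i.+1).
Proof.
apply: rationalM.
  by apply: rationalM; [exact: h_rat | exact: phi_rational].
apply/rationalV/rationalM.
  by apply: rationalM; [exact: h_rat | exact: phi_rational].
by apply: rationalD; [exact: (rational_nat _ 1) | exact: tau'_rational].
Qed.

Lemma sigma'_rational i : is_rational (sigma' h eps 2 tau1 i.+2).
Proof.
apply: rationalM.
  apply: rationalM; first exact: h_rat.
  apply: rationalD; first exact: phi_rational.
  by apply: rationalM; [exact: eps_rational | exact: tau_rational].
apply/rationalV/rationalM; [exact: h_rat | exact: phi_rational].
Qed.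
End RationalCoefficients.

(** * The result over the complex numbers *)

Local Open Scope complex_scope.

Theorem proposition4p3 (R : realType) (h : nat -> R[i])
    (h_neq0 : forall i, (0 < i)%N -> h i != 0) :
  (forall eps phi1 tau1 : R[i],
     eps = 1 \/ eps = -1 -> phi1 != 0 -> tau1 != 0 ->
     well_defined eps phi1 tau1 -> is_geometry h eps phi1 tau1) /\
  (forall eps tau1 : R[i],
     eps = 1 \/ eps = -1 -> tau1 != 0 -> well_defined eps 2 tau1 ->
     (forall i, (0 < i)%N -> is_rational (h i)) -> is_rational tau1 ->
     (forall i, (0 < i)%N ->
        [/\ is_rational (phi (2 : R[i]) i),
            is_rational (tau eps 2 tau1 i),
            is_rational (tau' eps 2 tau1 i)
          & is_rational (sigma h eps 2 tau1 i)]) /\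
     (forall i, (1 < i)%N -> is_rational (sigma' h eps 2 tau1 i))) /\
  (forall s : R[i],
     s = 1 \/ s = -1 ->
     [/\ well_defined 1 2 s,
         is_geometry h 1 2 s,
         forall i, (0 < i)%N ->
           [/\ phi (2 : R[i]) i = i.+1%:R / i%:R,
               tau 1 2 s i = s * (-1) ^+ i.-1 / i%:R,
               tau' 1 2 s i = - tau 1 2 s i.+1
             & sigma h 1 2 s i = h i.+1 / h i * (1 + tau 1 2 s i.+1)]
       & forall i, (1 < i)%N ->
           sigma' h 1 2 s i = h i.-1 / h i * (1 / (1 + tau 1 2 s i))]).
Proof.
split; [|split].
- move=> eps phi1 tau1 epsE _ _ wd; exact: edge_metric_geometry.
- move=> eps tau1 epsE _ _ h_rat tau1_rat; split; case=> // i i0.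
    split; [exact: phi_rational | exact: tau_rational
           |exact: tau'_rational | exact: sigma_rational].
  by case: i i0 => // i _; exact: sigma'_rational.
- move=> s sE; have s2 : s * s = 1 by case: sE => ->; rewrite ?mulrNN mulr1.
  have wd := well_defined_canonical s2.
  split; first exact: wd.
  + by apply: edge_metric_geometry => //; left.
  + case=> // i _; split; [exact: phi_canonical | exact: tau_canonical
      |exact: tau'_canonical | exact: sigma_canonical].
  + by case=> // -[] // i _; exact: sigma'_canonical.
Qed.
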